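(* Let $0\le\gamma<1$, $\alpha=\frac{4}{3+\gamma}$, let $\Omega\subset\mathbb{R}^n$ be a bounded smooth domain and $\varphi\ge0$ a smooth boundary datum, and let $u$ be a limit Perron's solution of the problem $$\Delta_\infty u=u^{-\gamma}\ \text{ in }\Omega\cap\{u>0\},\qquad u=\varphi\ \text{ on }\partial\Omega .$$ There exists a constant $c>0$, depending only on $\gamma$, such that for every $x\in\overline{\{u>0\}}\cap\Omega$ there holds $$\sup_{B_r(x)}u\ge c\,r^{\alpha}\qquad\text{for any }0<r\le\tfrac12\,\mathrm{dist}(x,\partial\Omega).$$
   Context: $\Delta_\infty u=\sum_{i,j}D_{ij}u\,D_iu\,D_ju$, understood in the viscosity sense. Fix $\delta=\frac12\alpha^{-4/(3+\gamma)}$ and a Lipschitz function $\mathcal{B}:\mathbb{R}\to\mathbb{R}$ with $0\le\mathcal{B}\le1$, $\mathcal{B}(s)=0$ for $s\le\delta/2$ and $\mathcal{B}(s)=1$ for $s\ge\delta$. For $\varepsilon>0$ put $\mathcal{B}_\varepsilon(s)=\mathcal{B}(s/\varepsilon^\alpha)$; the expression $\mathcal{B}_\varepsilon(s)s^{-\gamma}$ is taken to be $0$ for $s\le\frac{\delta}{2}\varepsilon^\alpha$. The penalized problem $(P_\varepsilon)$ is $$\Delta_\infty u=\mathcal{B}_\varepsilon(u)\,u^{-\gamma}\ \text{ in }\Omega,\qquad u=\varphi\ \text{ on }\partial\Omega .$$ Let $\underline u,\overline u\in C(\overline\Omega)$ be the viscosity solutions of $\Delta_\infty\underline u=(\delta/2)^{-\gamma}\varepsilon^{-\alpha\gamma}$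 and $\Delta_\infty\overline u=0$ in $\Omega$ with $\underline u=\overline u=\varphi$ on $\partial\Omega$. The minimal (Perron) solution of $(P_\varepsilon)$ is $$u_\varepsilon(x)=\inf\{w(x): w\in C(\overline\Omega)\text{ is a viscosity supersolution of }(P_\varepsilon),\ \underline u\le w\le\overline u\text{ in }\overline\Omega\},$$ where a viscosity supersolution satisfies $\Delta_\infty w\le\mathcal{B}_\varepsilon(w)w^{-\gamma}$ in the viscosity sense; $u_\varepsilon$ is a nonnegative continuous viscosity solution of $(P_\varepsilon)$. A limit Perron's solution is a function $u$ on $\Omega$ that is the limit, uniformly on compact subsets of $\Omega$, of minimal solutions $u_{\varepsilon_k}$ for some sequence $\varepsilon_k\to0^+$. *)

(* Defs.v *)
From HB Require Import structures.
From mathcomp Require Import all_boot all_order all_algebra.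
From mathcomp Require Import all_classical all_reals all_analysis.

Set Implicit Arguments.
Unset Strict Implicit.
Unset Printing Implicit Defensive.

Import Order.TTheory GRing.Theory Num.Theory.
Import numFieldNormedType.Exports.

Local Open Scope classical_set_scope.
Local Open Scope ring_scope.

(* The library norm on ['rV[R]_n] is the sup norm: it induces the right
   topology, but balls and distances have to be defined from [enorm]. *)
Definition enorm (R : realType) (n : nat) (x : 'rV[R]_n) : R :=
  Num.sqrt (\sum_(i < n) x ord0 i ^+ 2).

Definition eball (R : realType) (n : nat) (x : 'rV[R]_n) (r : R) :
  set 'rV[R]_n := [set y | enorm (y - x) < r].

Definition bdry (T : topologicalType) (A : set T) : set T :=
  closure A `\` interior A.

(* Junk value [0] when [A] is empty. *)
Definition euclid_dist (R : realType) (n : nat) (x : 'rV[R]_n) (A : set 'rV[R]_n) :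
  R := inf [set enorm (y - x) | y in A].

Definition partial (R : realType) (n : nat) (i : 'I_n) (f : 'rV[R]_n -> R) :
  'rV[R]_n -> R := 'D_(delta_mx ord0 i) f.

(* [f] is of class C^k on the open set [U] *)
Fixpoint Ck (R : realType) (n : nat) (k : nat) (U : set 'rV[R]_n)
    (f : 'rV[R]_n -> R) : Prop :=
  (forall x, U x -> {for x, continuous f}) /\
  if k is k'.+1 then
    forall i : 'I_n, (forall x, U x -> derivable f x (delta_mx ord0 i)) /\
                     Ck k' U (partial i f)
  else True.

Definition smooth (R : realType) (n : nat) (U : set 'rV[R]_n)
  (f : 'rV[R]_n -> R) : Prop := forall k, Ck k U f.

(* Near each boundary point, up to the choice [i] of an axis and its
   orientation [(-1) ^+ s], the set lies strictly above the graph of a smooth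
   function [g] of the [n.-1] remaining coordinates [col' i y]. *)
Definition smooth_boundary (R : realType) (n : nat) (Om : set 'rV[R]_n) :
    Prop :=
  forall x, bdry Om x ->
    exists (r : R) (i : 'I_n) (s : bool) (g : 'rV[R]_(n.-1) -> R),
      [/\ 0 < r, smooth setT g &
          forall y, eball x r y ->
            (Om y <-> g (col' i y) < (-1) ^+ s * y ord0 i)].

Definition bounded_smooth_domain (R : realType) (n : nat)
    (Om : set 'rV[R]_n) : Prop :=
  [/\ open Om, connected Om, Om !=set0, bounded_set Om & smooth_boundary Om].

Definition inf_laplacian (R : realType) (n : nat) (f : 'rV[R]_n -> R)
    (x : 'rV[R]_n) : R :=
  \sum_(i < n) \sum_(j < n)
    partial i (partial j f) x * partial i f x * partial j f x.

(* Viscosity notions for the equation [inf_laplacian w = F w] in [Om]; the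
   viscosity subsolutions are those with [inf_laplacian w >= F w]. *)
Definition viscosity_subsolution (R : realType) (n : nat) (Om : set 'rV[R]_n)
    (F : R -> R) (w : 'rV[R]_n -> R) : Prop :=
  forall (psi : 'rV[R]_n -> R) x, Om x -> Ck 2 Om psi ->
    (\forall y \near x, w y - psi y <= w x - psi x) ->
    F (w x) <= inf_laplacian psi x.

Definition viscosity_supersolution (R : realType) (n : nat)
    (Om : set 'rV[R]_n) (F : R -> R) (w : 'rV[R]_n -> R) : Prop :=
  forall (psi : 'rV[R]_n -> R) x, Om x -> Ck 2 Om psi ->
    (\forall y \near x, w x - psi x <= w y - psi y) ->
    inf_laplacian psi x <= F (w x).

Definition viscosity_dirichlet_solution (R : realType) (n : nat)
    (Om : set 'rV[R]_n) (F : R -> R) (phi w : 'rV[R]_n -> R) : Prop :=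
  [/\ {within closure Om, continuous w},
      viscosity_subsolution Om F w,
      viscosity_supersolution Om F w &
      forall x, bdry Om x -> w x = phi x].

Definition alpha (R : realType) (gamma : R) : R := 4 / (3 + gamma).

Definition delta (R : realType) (gamma : R) : R :=
  2^-1 * alpha gamma `^ (- (4 / (3 + gamma))).

Definition cutoff (R : realType) (gamma : R) (B : R -> R) : Prop :=
  [/\ lipschitz B,
      forall s, 0 <= B s <= 1,
      forall s, s <= delta gamma / 2 -> B s = 0 &
      forall s, delta gamma <= s -> B s = 1].

(* [B_eps(s) s^-gamma]; the test avoids the value of [powR] at [s <= 0], which
   need not vanish. *)
Definition penalization (R : realType) (gamma : R) (B : R -> R) (eps s : R) :
    R :=
  if s <= delta gamma / 2 * eps `^ alpha gamma then 0
  else B (s / eps `^ alpha gamma) * s `^ (- gamma).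

Definition perron_class (R : realType) (n : nat) (gamma : R) (B : R -> R)
    (Om : set 'rV[R]_n) (eps : R) (ul uo : 'rV[R]_n -> R) :
    set ('rV[R]_n -> R) :=
  [set w | [/\ {within closure Om, continuous w},
               viscosity_supersolution Om (penalization gamma B eps) w &
               forall x, closure Om x -> ul x <= w x <= uo x]].

Definition minimal_solution (R : realType) (n : nat) (gamma : R) (B : R -> R)
    (Om : set 'rV[R]_n) (phi : 'rV[R]_n -> R) (eps : R)
    (ue : 'rV[R]_n -> R) : Prop :=
  exists ul uo : 'rV[R]_n -> R,
    [/\ viscosity_dirichlet_solution Om
          (fun=> (delta gamma / 2) `^ (- gamma) *
                 eps `^ (- (alpha gamma * gamma))) phi ul,
        viscosity_dirichlet_solution Om (fun=> 0) phi uo &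
        forall x, closure Om x ->
          ue x = inf [set w x | w in perron_class gamma B Om eps ul uo]].

(* Only the values of [u] on [Om] matter. *)
Definition limit_perron_solution (R : realType) (n : nat) (gamma : R)
    (B : R -> R) (Om : set 'rV[R]_n) (phi u : 'rV[R]_n -> R) : Prop :=
  exists (eps : nat -> R) (ue : nat -> 'rV[R]_n -> R),
    [/\ forall k, 0 < eps k,
        eps @ \oo --> 0,
        forall k, minimal_solution gamma B Om phi (eps k) (ue k) &
        forall K : set 'rV[R]_n, compact K -> K `<=` Om ->
          {uniform K, ue @ \oo --> u}].

Definition positivity_set (R : realType) (n : nat) (Om : set 'rV[R]_n)
  (u : 'rV[R]_n -> R) : set 'rV[R]_n := [set x | Om x /\ 0 < u x].

(* Main.v *)
(* With delta = alpha^(-alpha) / 2, the smooth function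
     Theta(y) = delta (|y - x'|^2 + eps^2)^(alpha / 2)
   satisfies Theta >= delta eps^alpha, so the cutoff equals 1 along Theta, and
   Delta_infty Theta < Theta^(-gamma) <= (delta / 2)^(-gamma) eps^(-alpha gamma):
   it is a strict supersolution of (P_eps) lying above the lower barrier as soon
   as it does so on a sphere.  If u were smaller than delta rho^alpha on a ball
   B_rho(x') with u(x') > 0, then for small eps some w in the Perron class would
   satisfy w < Theta on the sphere; replacing w by min(w, Theta) inside the ball
   stays in the Perron class, so minimality gives
   u_eps(x') <= Theta(x') = delta eps^alpha, and u(x') <= 0 in the limit. *)
Require Import Defs.
From HB Require Import structures.
From mathcomp Require Import all_boot all_order all_algebra.
From mathcomp Require Import all_classical all_reals all_analysis.
From mathcomp Require Import ring lra.
Import Order.TTheory GRing.Theory Num.Theory.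
Import numFieldNormedType.Exports.
Local Open Scope classical_set_scope.
Local Open Scope ring_scope.
Set Implicit Arguments.
Unset Strict Implicit.
Unset Printing Implicit Defensive.

(** * Directional derivatives and interior minima *)

Lemma is_derive_cvgP (R : realType) (V : normedModType R) (f : V -> R)
    (a v : V) (d : R) :
  is_derive a v f d <-> h^-1 * (f (a + h *: v) - f a) @[h --> 0^'] --> d.
Proof.
have E : (fun h : R => h^-1 * (f (a + h *: v) - f a)) =
         (fun h => h^-1 *: ((f \o shift a) (h *: v) - f a)).
  by apply/funext => h /=; rewrite [a + _]addrC.
split=> [[df <-]|]; first by rewrite E; exact: df.
rewrite E => fd; apply: DeriveDef; first by apply/cvg_ex; exists d.
exact: cvg_lim.
Qed.

Lemma is_derive_line (R : realType) (V : normedModType R) (f : V -> R)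
    (a v : V) (t d : R) :
  is_derive (a + t *: v) v f d <-> is_derive t 1 (fun s => f (a + s *: v)) d.
Proof.
rewrite !is_derive_cvgP.
suff -> : (fun h : R => h^-1 * (f (a + t *: v + h *: v) - f (a + t *: v))) =
          (fun h => h^-1 * (f (a + (t + h *: 1) *: v) - f (a + t *: v))) by [].
by apply/funext => h; rewrite [h *: 1]mulr1 scalerDl addrA.
Qed.

(** The mean value theorem turns the increment into [(dg c - L) * b]. Both signs of [b] are treated
    because the increments to which it is applied are products [h * a] of arbitrary sign. *)
Lemma mean_value_bound (R : realType) (g dg : R -> R) (b L e : R) :
  (forall s : R, `|s| <= `|b| -> is_derive s 1 g (dg s) /\ `|dg s - L| <= e) ->
  `|g b - g 0 - L * b| <= e * `|b|.
Proof.
move=> Hg.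
have Cg (s : R) : `|s| <= `|b| -> {for s, continuous g}.
  move=> /Hg[[dgs _] _]; apply/differentiable_continuous.
  exact/derivable1_diffP.
have [b0|b0|->] := ltgtP b 0; last by rewrite subrr sub0r normrN normr0 !mulr0 normr0.
- have [||c cb E] := @MVT R g dg b 0 b0.
  + move=> x; rewrite in_itv/= => /andP[bx x0].
    by apply: (Hg _ _).1; rewrite !ltr0_norm // lerN2 ltW.
  + apply: continuous_in_subspaceT => x.
    rewrite inE/= in_itv/= => /andP[bx x0]; apply: Cg.
    by rewrite (ltr0_norm b0) ler0_norm // lerN2.
  move: cb; rewrite in_itv/= => /andP[bc c0].
  have -> : g b - g 0 - L * b = (dg c - L) * b.
    by rewrite -[g b - g 0]opprB E; ring.
  rewrite normrM ler_wpM2r//; apply: (Hg _ _).2.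
  by rewrite !ltr0_norm // lerN2 ltW.
- have [||c cb E] := @MVT R g dg 0 b b0.
  + move=> x; rewrite in_itv/= => /andP[x0 bx].
    by apply: (Hg _ _).1; rewrite !gtr0_norm // ltW.
  + apply: continuous_in_subspaceT => x.
    rewrite inE/= in_itv/= => /andP[x0 bx]; apply: Cg.
    by rewrite (gtr0_norm b0) ger0_norm.
  move: cb; rewrite in_itv/= => /andP[c0 bc].
  have -> : g b - g 0 - L * b = (dg c - L) * b.
    by rewrite E; ring.
  rewrite normrM ler_wpM2r//; apply: (Hg _ _).2.
  by rewrite !gtr0_norm // ltW.
Qed.

(** The increment is split at [y + h *: v]. The first piece is the given derivative; the second runs
    along [e] from a moving base point, where the mean value bound and the continuity of ['D_e f] at
    [y] give the limit. *)
Lemma is_derive_addv (R : realType) (V : normedModType R) (f : V -> R)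
    (y v e : V) (a D : R) :
  is_derive y v f D -> (\forall z \near y, derivable f z e) ->
  {for y, continuous ('D_e f)} ->
  is_derive y (v + a *: e) f (D + a * 'D_e f y).
Proof.
move=> /is_derive_cvgP fD dfe cfe; apply/is_derive_cvgP.
have -> : (fun h : R => h^-1 * (f (y + h *: (v + a *: e)) - f y)) =
  (fun h => h^-1 * (f (y + h *: v) - f y) +
     h^-1 * (f (y + h *: v + (h * a) *: e) - f (y + h *: v))).
  apply/funext => h; rewrite -mulrDr scalerDr scalerA addrA; congr (_ * _); ring.
apply: cvgD => //.
apply/cvgrPdist_le => eps eps0.
(* The tolerance [eps / (|a| + 1)] absorbs the factor [|a|] and also covers [a = 0]. *)
have a1 : 0 < `|a| + 1 by rewrite ltr_wpDl.
have /nbhs_ballP[r /= r0 Br] : \forall z \near y, derivable f z e /\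
    `|'D_e f z - 'D_e f y| <= eps / (`|a| + 1).
  near=> z; split; first by near: z.
  rewrite distrC; near: z; move/cvgrPdist_le : cfe; apply.
  exact: divr_gt0.
have M0 : 0 < `|v| + `|a| * `|e| + 1.
  by rewrite ltr_wpDl// addr_ge0// mulr_ge0.
have key : \forall h \near (0 : R)^', h != 0 /\ `|h| * (`|v| + `|a| * `|e| + 1) < r.
  near=> h; split; first by near: h; exact: nbhs_dnbhs_neq.
  rewrite -ltr_pdivlMr//; near: h; exact: (dnbhs0_lt (divr_gt0 r0 M0)).
near=> h.
have [h0 hr] : h != 0 /\ `|h| * (`|v| + `|a| * `|e| + 1) < r by near: h.
have := @mean_value_bound R (fun s => f (y + h *: v + s *: e))
   (fun s => 'D_e f (y + h *: v + s *: e)) (h * a) ('D_e f y) (eps / (`|a| + 1)).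
rewrite scale0r addr0 => H.
have {H} H := H _.
have : forall s : R, `|s| <= `|h * a| ->
    is_derive s 1 (fun s => f (y + h *: v + s *: e))
      ('D_e f (y + h *: v + s *: e)) /\
    `|'D_e f (y + h *: v + s *: e) - 'D_e f y| <= eps / (`|a| + 1).
  move=> s sh; rewrite -is_derive_line.
  have /Br [dz Dz] : ball y r (y + h *: v + s *: e).
    rewrite -ball_normE /= -addrA opprD addNKr normrN.
    apply: le_lt_trans hr.
    rewrite (le_trans (ler_normD _ _))// !normrZ mulrDr mulrDr mulr1.
    rewrite -addrA lerD2l mulrA.
    rewrite -[X in X <= _]addr0 lerD//; rewrite ?normr_ge0//.
    by rewrite ler_wpM2r// -normrM.
  by split => //; exact: DeriveDef.
move=> /H {}H.
have -> : a * 'D_e f y - h^-1 * (f (y + h *: v + (h * a) *: e) - f (y + h *: v))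
  = - h^-1 * (f (y + h *: v + (h * a) *: e) - f (y + h *: v) - 'D_e f y * (h * a)).
  by field.
rewrite normrM normrN normfV mulrC ler_pdivrMr ?normr_gt0//.
apply: (le_trans H); rewrite normrM.
have -> : eps / (`|a| + 1) * (`|h| * `|a|) = (eps * `|h|) * (`|a| / (`|a| + 1)).
  by ring.
rewrite ler_piMr//; first by rewrite mulr_ge0// ltW.
by rewrite ler_pdivrMr// mul1r lerDl.
Unshelve. all: by end_near.
Qed.

(** Continuous partial derivatives yield every directional derivative: [v] is built up one
    coordinate at a time with [is_derive_addv]. *)
Lemma C1_is_derive (R : realType) (n : nat) (U : set 'rV[R]_n)
    (f : 'rV[R]_n -> R) :
  open U -> Ck 1 U f -> forall z v, U z ->
  is_derive z v f (\sum_(i < n) v ord0 i * partial i f z).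
Proof.
move=> oU [_ Hf] z v Uz; rewrite [X in is_derive _ X]row_sum_delta.
elim/big_rec2: _ => [|i d w _ IH].
  apply/is_derive_cvgP; under eq_fun do rewrite scaler0 addr0 subrr mulr0.
  exact: cvg_cst.
rewrite addrC [X in is_derive _ _ _ X]addrC; have [Hd [Hc _]] := Hf i.
apply: is_derive_addv => //; last exact: Hc.
apply: filterS (open_nbhs_nbhs (conj oU Uz)) => y; exact: Hd.
Qed.

Lemma first_derivative_local_min (R : realType) (F F1 : R -> R) :
  (\forall t \near (0 : R), is_derive (t : R) (1 : R) F (F1 t)) ->
  (\forall t \near (0 : R), F 0 <= F t) -> F1 0 = 0.
Proof.
move=> dF mF.
have d0 : is_derive (0 : R) 1 F (F1 0) by exact: nbhs_singleton dF.
have [r /= r0 Br] := (nbhs_ballP _ _).1 (filterI dF mF).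
have Bt t : t \in `]- r, r[ -> ball (0 : R) r t.
  by rewrite -ball_normE /= sub0r normrN in_itv/= ltr_norml.
have D := @derive1_at_min R F (- r) r 0 _ _ _ _.
rewrite -(@derive_val _ _ _ _ _ _ _ d0); apply: derive_val; apply: D.
- by rewrite ge0_cp // ltW.
- by move=> t /Bt /Br[[]].
- by rewrite in_itv/= oppr_lt0 r0.
- by move=> t /Bt /Br[].
Qed.

(** If [d < 0], then [F1 0 = 0] forces [F1 < 0] just to the right of [0], and the mean value theorem
    gives [F b < F 0] for a small [b > 0]. *)
Lemma second_derivative_local_min (R : realType) (F F1 : R -> R) (d : R) :
  (\forall t \near (0 : R), is_derive (t : R) (1 : R) F (F1 t)) ->
  is_derive (0 : R) 1 F1 d -> (\forall t \near (0 : R), F 0 <= F t) -> 0 <= d.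
Proof.
move=> dF /is_derive_cvgP dF1 mF; have F10 := first_derivative_local_min dF mF.
rewrite leNgt; apply/negP => d0.
have : \forall t \near (0 : R)^', t^-1 * F1 t < 0.
  have /cvgr_lt -/(_ 0 d0) := dF1.
  by apply: filterS => t; rewrite add0r [t *: 1]mulr1 F10 subr0.
rewrite near_withinE.
move=> /(nbhs_ballP _ _)[r1 /= r10 B1].
have [r2 /= r20 B2] := (nbhs_ballP _ _).1 dF.
have [r3 /= r30 B3] := (nbhs_ballP _ _).1 mF.
pose b := Num.min r1 (Num.min r2 r3) / 2.
have m0 : 0 < Num.min r1 (Num.min r2 r3) by rewrite !lt_min r10 r20 r30.
have b0 : 0 < b by exact: divr_gt0.
have [b1 b2 b3] : [/\ b < r1, b < r2 & b < r3].
  have : b < Num.min r1 (Num.min r2 r3) by rewrite /b; lra.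
  by rewrite !lt_min => /and3P[].
have ball0 (s r : R) : `|s| < r -> ball 0 r s.
  by rewrite -ball_normE /= sub0r normrN.
have [||c cb E] := @MVT R F F1 0 b b0.
- move=> x; rewrite in_itv/= => /andP[x0 xb]; apply: B2; apply: ball0.
  by rewrite gtr0_norm// (lt_trans xb).
- apply: continuous_in_subspaceT => x; rewrite inE/= in_itv/= => /andP[x0 xb].
  apply/differentiable_continuous/derivable1_diffP.
  suff [] : is_derive x 1 F (F1 x) by [].
  by apply: B2; apply: ball0; rewrite ger0_norm// (le_lt_trans xb).
move: cb; rewrite in_itv/= => /andP[c0 cb].
have : F 0 <= F b by apply: B3; apply: ball0; rewrite gtr0_norm.
rewrite -subr_ge0 E subr0 pmulr_lge0// leNgt => /negP; apply.
have := B1 c; rewrite /= (gt_eqF c0) => /(_ _ isT).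
rewrite pmulr_rlt0 ?invr_gt0//; apply; apply: ball0.
by rewrite gtr0_norm// (lt_trans cb).
Qed.

(** At the minimum of [f - psi] the gradients coincide. With [v] this common gradient, the infinity
    Laplacian of either function is its second derivative along [v], so the one-variable test on the
    line [x + t *: v] decides. *)
Lemma inf_laplacian_local_min (R : realType) (n : nat) (U : set 'rV[R]_n)
    (f psi : 'rV[R]_n -> R) (x : 'rV[R]_n) :
  open U -> U x -> Ck 2 U f -> Ck 2 U psi ->
  (\forall y \near x, f x - psi x <= f y - psi y) ->
  inf_laplacian psi x <= inf_laplacian f x.
Proof.
move=> oU Ux Cf Cpsi mx.
have C21 g : Ck 2 U g -> Ck 1 U g.
  by move=> [cg Hg]; split => // i; have [? [? _]] := Hg i; split.
have line_cvg (v : 'rV[R]_n) : (x + t *: v) @[t --> (0 : R)] --> x.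
  rewrite -[X in _ --> X]addr0 -(scale0r v).
  by apply: cvgD; [exact: cvg_cst | apply: cvgZr_tmp; exact: cvg_id].
have linear_near (v : 'rV[R]_n) : \forall t \near (0 : R), U (x + t *: v).
  apply: (line_cvg v U); exact: open_nbhs_nbhs.
have min_near (v : 'rV[R]_n) : \forall t \near (0 : R),
    f (x + 0 *: v) - psi (x + 0 *: v) <= f (x + t *: v) - psi (x + t *: v).
  by rewrite scale0r addr0; exact: (line_cvg v _ mx).
pose D (g : 'rV[R]_n -> R) (v z : 'rV[R]_n) : R := \sum_(i < n) v ord0 i * partial i g z.
have dfirst (v : 'rV[R]_n) : \forall t \near (0 : R),
    is_derive (t : R) (1 : R) (fun t => f (x + t *: v) - psi (x + t *: v))
      (D f v (x + t *: v) - D psi v (x + t *: v)).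
  apply: filterS (linear_near v) => t Ut.
  have H g : Ck 2 U g -> is_derive t 1 (fun t => g (x + t *: v)) (D g v (x + t *: v)).
    by move=> /C21 Cg; exact: (is_derive_line g x v t _).1 (C1_is_derive oU Cg v Ut).
  exact: is_deriveB (H f Cf) (H psi Cpsi).
have dsecond (g : 'rV[R]_n -> R) (v : 'rV[R]_n) : Ck 2 U g ->
  is_derive (0 : R) 1 (fun t => D g v (x + t *: v))
   (\sum_(i < n) v ord0 i * D (partial i g) v x).
  move=> [_ Hg]; apply: (is_derive_line (D g v) x v 0 _).1; rewrite scale0r addr0.
  rewrite /D; have := @is_derive_sum R _ _ n (fun i z => v ord0 i * partial i g z) x v
    (fun i => v ord0 i * D (partial i g) v x).
  rewrite fct_sumE => H; apply: H => i.
  have Hi := C1_is_derive oU (proj2 (Hg i)) v Ux.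
  exact: is_deriveZ.
(* First-order condition along each coordinate axis. *)
have grad i : partial i psi x = partial i f x.
  have := first_derivative_local_min (dfirst (delta_mx ord0 i)) (min_near _).
  rewrite /= scale0r addr0 => /eqP; rewrite subr_eq0 => /eqP.
  rewrite /D (bigD1 i)//= big1 ?addr0; last first.
    by move=> j ji; rewrite mxE eqxx/= (negPf ji) mul0r.
  rewrite (bigD1 i)//= big1 ?addr0; last first.
    by move=> j ji; rewrite mxE eqxx/= (negPf ji) mul0r.
  by rewrite mxE !eqxx !mul1r.
pose v := \row_(i < n) partial i f x.
(* The order of summation is exchanged to match the iterated derivative along [v]; symmetry of the
   Hessian is not invoked. *)
have E g : (forall i, partial i g x = partial i f x) ->
    inf_laplacian g x = \sum_(i < n) v ord0 i * D (partial i g) v x.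
  move=> gf; rewrite /inf_laplacian exchange_big/=; apply: eq_bigr => i _.
  rewrite /D mulr_sumr; apply: eq_bigr => j _.
  by rewrite !mxE !gf; ring.
rewrite (E f (fun=> erefl)) (E psi grad) -subr_ge0.
apply: second_derivative_local_min (dfirst v) _ (min_near v).
exact: is_deriveB (dsecond f v Cf) (dsecond psi v Cpsi).
Qed.

(** * The barrier *)

Definition sqnorm (R : realType) (n : nat) (x : 'rV[R]_n) : R :=
  \sum_(i < n) x ord0 i ^+ 2.

Lemma sqnorm_ge0 (R : realType) (n : nat) (x : 'rV[R]_n) : 0 <= sqnorm x.
Proof. by apply: sumr_ge0 => i _; exact: sqr_ge0. Qed.

Lemma sqnormDdelta (R : realType) (n : nat) (x : 'rV[R]_n) (h : R) (i : 'I_n) :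
  sqnorm (x + h *: delta_mx ord0 i) = sqnorm x + h * (2 * x ord0 i + h).
Proof.
rewrite /sqnorm (bigD1 i)//= [in RHS](bigD1 i)//= !mxE !eqxx mulr1.
rewrite (eq_bigr (fun j => x ord0 j ^+ 2)); first by ring.
by move=> j ji; rewrite !mxE eqxx (negPf ji) mulr0 addr0.
Qed.

Lemma is_derive_powR_comp (R : realType) (V : normedModType R) (f : V -> R)
    (y v : V) (d p : R) : 0 < f y -> is_derive y v f d ->
  is_derive y v (fun z => f z `^ p) (p * f y `^ (p - 1) * d).
Proof.
move=> fy fd.
have := (is_derive_line (fun z => f z `^ p) y v 0 (p * f y `^ (p - 1) * d)).2.
rewrite scale0r addr0; apply.
have fd' := (is_derive_line f y v 0 d).1.
rewrite scale0r addr0 in fd'; have {}fd' := fd' fd.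
apply: (@is_derive1_comp _ (fun r => r `^ p) (fun s : R => f (y + s *: v))) => //.
by rewrite scale0r addr0; exact: is_derive1_powR.
Qed.

Lemma continuous_powR_comp (R : realType) (V : normedModType R) (f : V -> R)
    (y : V) (p : R) : 0 < f y -> {for y, continuous f} ->
  {for y, continuous (fun z => f z `^ p)}.
Proof.
move=> fy fc; apply: (@continuous_comp _ _ _ f (fun r => r `^ p)) => //.
apply/differentiable_continuous/derivable1_diffP.
by have [] := is_derive1_powR p fy.
Qed.

Lemma is_derive_coord (R : realType) (n : nat) (x0 y : 'rV[R]_n) (i j : 'I_n) :
  is_derive y (delta_mx ord0 i) (fun z : 'rV[R]_n => (z - x0) ord0 j) (i == j)%:R.
Proof.
apply/is_derive_cvgP; apply: (@cvg_trans _ ((fun=> (i == j)%:R : R) @ (0 : R)^')); last exact: cvg_cst.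
apply: near_eq_cvg; near=> h.
have h0 : h != 0 by near: h; exact: nbhs_dnbhs_neq.
by rewrite !mxE eqxx eq_sym /=; field.
Unshelve. all: by end_near.
Qed.

Lemma continuous_coordB (R : realType) (n : nat) (x0 y : 'rV[R]_n) (j : 'I_n) :
  {for y, continuous (fun z : 'rV[R]_n => (z - x0) ord0 j)}.
Proof.
have -> : (fun z : 'rV[R]_n => (z - x0) ord0 j) = (fun z => z ord0 j - x0 ord0 j).
  by apply/funext => z; rewrite !mxE.
apply: continuousB; last exact: cst_continuous.
exact: (@coord_continuous R 1 n ord0 j y).
Qed.

Lemma continuous_sqnormB (R : realType) (n : nat) (x0 y : 'rV[R]_n) :
  {for y, continuous (fun z : 'rV[R]_n => sqnorm (z - x0))}.
Proof.
suff cont_seq r : continuous_at y (fun z : 'rV[R]_n => \sum_(i <- r) (z - x0) ord0 i ^+ 2).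
  exact: cont_seq.
elim: r => [|i r IH].
  by under eq_fun do rewrite big_nil; exact: cst_continuous.
under eq_fun do rewrite big_cons expr2.
have Hc := @continuous_coordB R n x0 y i.
exact: (@continuousD _ _ _ _ _ y (continuousM Hc Hc) IH).
Qed.

Section barrier.
Variables (R : realType) (gamma : R) (n : nat) (eps : R) (x0 : 'rV[R]_n).
Hypothesis eps0 : 0 < eps.

Local Notation a := (alpha gamma).
Let S (z : 'rV[R]_n) : R := sqnorm (z - x0) + eps ^+ 2.

(** The radial profile [delta * |y - x0|^alpha], regularized by [eps ^+ 2] so that the base of the
    power stays positive and the function is C^2 at the centre too. *)
Definition barrier (y : 'rV[R]_n) : R :=
  delta gamma * (sqnorm (y - x0) + eps ^+ 2) `^ (alpha gamma / 2).

Let S_gt0 z : 0 < S z.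
Proof. by rewrite ltr_wpDl ?sqnorm_ge0// exprn_gt0. Qed.

Let is_derive_S y i : is_derive y (delta_mx ord0 i) S (2 * (y - x0) ord0 i).
Proof.
apply/is_derive_cvgP.
apply: (@cvg_trans _ ((fun h => 2 * (y - x0) ord0 i + h) @ (0 : R)^')).
  apply: near_eq_cvg; near=> h.
  have h0 : h != 0 by near: h; exact: nbhs_dnbhs_neq.
  have E : y + h *: delta_mx ord0 i - x0 = (y - x0) + h *: delta_mx ord0 i by rewrite addrAC.
  by rewrite /S E sqnormDdelta; field.
have : (2 * (y - x0) ord0 i + h) @[h --> (0 : R)^'] --> 2 * (y - x0) ord0 i + 0.
  by apply: cvgD; [exact: cvg_cst | exact: nbhs_dnbhs].
by rewrite addr0.
Unshelve. all: by end_near.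
Qed.

Let continuous_S y p : {for y, continuous (fun z => S z `^ p)}.
Proof.
apply: continuous_powR_comp (S_gt0 y) _.
exact: (continuousD (@continuous_sqnormB _ _ x0 y) (@cst_continuous _ _ _ y)).
Qed.

Let is_derive_Sp y i p :
  is_derive y (delta_mx ord0 i) (fun z => S z `^ p) (p * S y `^ (p - 1) * (2 * (y - x0) ord0 i)).
Proof. exact: is_derive_powR_comp (S_gt0 y) (is_derive_S y i). Qed.

(** Closed forms of the gradient ([d1]) and of the Hessian ([d2]) of the barrier. *)
Let d1 i z := delta gamma * a * (S z `^ (a / 2 - 1) * (z - x0) ord0 i).

Let d2 j i z := delta gamma * a *
  ((a - 2) * S z `^ (a / 2 - 2) * (z - x0) ord0 i * (z - x0) ord0 j +
   (j == i)%:R * S z `^ (a / 2 - 1)).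

Let is_derive1_barrier y i : is_derive y (delta_mx ord0 i) barrier (d1 i y).
Proof.
have H := is_deriveZ (delta gamma) (is_derive_Sp y i (a / 2)).
apply: is_derive_eq H _; rewrite /d1 /GRing.scale /=; by field.
Qed.

Let is_derive2_barrier y i j : is_derive y (delta_mx ord0 j) (d1 i) (d2 j i y).
Proof.
have H := is_deriveZ (delta gamma * a)
  (is_deriveM (is_derive_Sp y j (a / 2 - 1)) (is_derive_coord x0 y j i)).
apply: is_derive_eq H _; rewrite /d2 /GRing.scale /=.
have -> : a / 2 - 1 - 1 = a / 2 - 2 by ring.
by field.
Qed.

Let partial_barrier i : partial i barrier = d1 i.
Proof. by apply/funext => y; have [_] := is_derive1_barrier y i. Qed.

Let partial2_barrier i j : partial j (partial i barrier) = d2 j i.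
Proof.
rewrite partial_barrier; apply/funext => y.
by have [_] := is_derive2_barrier y i j.
Qed.

Lemma Ck2_barrier U : Ck 2 U barrier.
Proof.
split=> [x _|i].
  exact: (continuousM (@cst_continuous _ _ _ x) (@continuous_S x _)).
split=> [x _|]; first by have [] := is_derive1_barrier x i.
split=> [x _|j].
  rewrite partial_barrier.
  exact: (continuousM (@cst_continuous _ _ _ x)
    (continuousM (@continuous_S x _) (@continuous_coordB _ _ x0 x i))).
split=> [x _|]; first by rewrite partial_barrier; have [] := is_derive2_barrier x i j.
split=> // x _; rewrite partial2_barrier.
exact: (continuousM (@cst_continuous _ _ _ x) (continuousD (continuousM (continuousM
  (continuousM (@cst_continuous _ _ _ x) (@continuous_S x _))
  (@continuous_coordB _ _ x0 x i)) (@continuous_coordB _ _ x0 x j))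
  (continuousM (@cst_continuous _ _ _ x) (@continuous_S x _)))).
Qed.

(** The Hessian is a rank-one term along [y - x0] plus a multiple of the identity. Contracting it
    twice with the gradient, itself parallel to [y - x0], leaves only powers of [S] and of
    [sqnorm (y - x0)]. *)
Lemma inf_laplacian_barrierE y :
  inf_laplacian barrier y = (delta gamma * a) ^+ 3 * (S y `^ (a / 2 - 1)) ^+ 2 *
   ((a - 2) * S y `^ (a / 2 - 2) * sqnorm (y - x0) ^+ 2
    + S y `^ (a / 2 - 1) * sqnorm (y - x0)).
Proof.
rewrite /inf_laplacian.
under eq_bigr => i _ do under eq_bigr => j _ do rewrite partial2_barrier !partial_barrier.
set P := S y `^ (a / 2 - 1); set Q := S y `^ (a / 2 - 2).
pose z i := (y - x0) ord0 i.
rewrite (eq_bigr (fun i => (delta gamma * a) ^+ 3 * P ^+ 2 *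
   ((a - 2) * Q * sqnorm (y - x0) * z i ^+ 2 + P * z i ^+ 2))).
  rewrite -mulr_sumr big_split/= -[in X in X + _]mulr_sumr.
  rewrite -[in X in _ + X]mulr_sumr.
  have -> : \sum_(i < n) z i ^+ 2 = sqnorm (y - x0) by [].
  ring.
move=> i _.
rewrite (eq_bigr (fun j => (delta gamma * a) ^+ 3 * P ^+ 2 *
   ((a - 2) * Q * z i ^+ 2 * z j ^+ 2 + (i == j)%:R * P * z i * z j))); last first.
  by move=> j _; rewrite /d1 /d2 -/P -/Q -/(z i) -/(z j); ring.
rewrite -mulr_sumr big_split/= -mulr_sumr; congr (_ * (_ + _)).
  by rewrite /sqnorm; ring.
rewrite (bigD1 i)//= big1 ?addr0 => [|j /negPf ji]; first by rewrite eqxx mul1r; ring.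
by rewrite eq_sym ji !mul0r.
Qed.
End barrier.

(** * Constants and the strict supersolution inequality *)

Lemma ler_powRN (R : realType) (p x y : R) :
  0 <= p -> 0 < x -> x <= y -> y `^ (- p) <= x `^ (- p).
Proof.
move=> p0 x0 xy; rewrite !powRN lef_pV2 ?posrE ?powR_gt0//; last exact: lt_le_trans xy.
by apply: ge0_ler_powR; rewrite ?nnegrE// ltW// (lt_le_trans x0).
Qed.

Section constants.
Variables (R : realType) (gamma : R).
Hypothesis hgamma : 0 <= gamma < 1.

(** This is the scaling balance [3 alpha - 4 = - alpha gamma] between the degrees of the two sides
    of the equation on [|y|^alpha]. *)
Lemma alphaM : alpha gamma * (3 + gamma) = 4.
Proof. by rewrite /alpha mulfVK// gt_eqF//; case/andP: hgamma => ? ?; lra. Qed.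

Lemma alpha_gt1 : 1 < alpha gamma.
Proof. by rewrite /alpha; case/andP: hgamma => ? ?; rewrite ltr_pdivlMr; lra. Qed.

Lemma alpha_lt2 : alpha gamma < 2.
Proof. by rewrite /alpha; case/andP: hgamma => ? ?; rewrite ltr_pdivrMr; lra. Qed.

Lemma delta_gt0 : 0 < delta gamma.
Proof. by rewrite mulr_gt0// powR_gt0// (lt_trans ltr01 alpha_gt1). Qed.

(** After multiplication by [delta^gamma], the identity [alpha (3 + gamma) = 4] reduces the left
    side to [2^-(3 + gamma) / alpha], which is below [1]. *)
Lemma delta_alpha3 : (delta gamma * alpha gamma) ^+ 3 < delta gamma `^ (- gamma).
Proof.
have d0 := delta_gt0; have a1 := alpha_gt1; have am := alphaM.
have a0 : 0 < alpha gamma by lra.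
case/andP: hgamma => g0 g1.
rewrite powRN -[ltRHS]div1r ltr_pdivlMr ?powR_gt0//.
have -> : (delta gamma * alpha gamma) ^+ 3 * delta gamma `^ gamma =
   delta gamma `^ (3 + gamma) * alpha gamma ^+ 3.
  rewrite powRD; last by rewrite (gt_eqF d0) implybT.
  by rewrite powR_mulrn ?ltW//; ring.
have -> : delta gamma `^ (3 + gamma) = 2^-1 `^ (3 + gamma) * (alpha gamma ^+ 4)^-1.
  rewrite {1}/delta powRM ?powR_ge0//; congr (_ * _).
  by rewrite -powRrM mulNr -/(alpha gamma) am powRN powR_mulrn ?ltW.
have -> : 2^-1 `^ (3 + gamma) * (alpha gamma ^+ 4)^-1 * alpha gamma ^+ 3 =
   2^-1 `^ (3 + gamma) / alpha gamma by field; rewrite gt_eqF.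
rewrite ltr_pdivrMr// mul1r (le_lt_trans _ a1)//.
apply: (@le_trans _ _ 2^-1); last by lra.
by apply: ge1r_powR; lra.
Qed.

Variables (n : nat) (eps : R) (x0 : 'rV[R]_n).
Hypothesis eps0 : 0 < eps.

(** Serves twice: [t = eps] gives the global lower bound, and [t] equal to the radius gives the
    bound on a sphere. *)
Lemma barrier_ge t y : 0 <= t -> t ^+ 2 <= sqnorm (y - x0) + eps ^+ 2 ->
  delta gamma * t `^ alpha gamma <= barrier gamma eps x0 y.
Proof.
move=> t0 ty; rewrite ler_pM2l ?delta_gt0//.
have a1 := alpha_gt1.
have -> : t `^ alpha gamma = (t ^+ 2) `^ (alpha gamma / 2).
  by rewrite -powR_mulrn// -powRrM; congr (_ `^ _); field.
apply: ge0_ler_powR => //; first by lra.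
- by rewrite nnegrE exprn_ge0.
- by rewrite nnegrE addr_ge0 ?sqnorm_ge0// exprn_ge0// ltW.
Qed.

Lemma barrier_center : barrier gamma eps x0 x0 = delta gamma * eps `^ alpha gamma.
Proof.
rewrite /barrier subrr /sqnorm big1 ?add0r => [|i _]; last by rewrite mxE expr0n.
rewrite -powR_mulrn ?ltW// -powRrM; congr (_ * _ `^ _); by field.
Qed.

Lemma barrier_ge_eps y : delta gamma * eps `^ alpha gamma <= barrier gamma eps x0 y.
Proof. by apply: barrier_ge; [exact: ltW | rewrite lerDr sqnorm_ge0]. Qed.

Lemma inf_laplacian_barrier_lt y :
  inf_laplacian (barrier gamma eps x0) y < barrier gamma eps x0 y `^ (- gamma).
Proof.
have a1 := alpha_gt1; have a2 := alpha_lt2; have am := alphaM; have d0 := delta_gt0.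
rewrite (inf_laplacian_barrierE gamma x0 eps0).
have q0 : 0 <= sqnorm (y - x0) := sqnorm_ge0 _.
rewrite /barrier; set q := sqnorm (y - x0) in q0 *.
have qs : q <= q + eps ^+ 2 by rewrite lerDl exprn_ge0// ltW.
have s0 : 0 < q + eps ^+ 2 by rewrite ltr_wpDl// exprn_gt0.
set s := q + eps ^+ 2 in qs s0 *.
rewrite powRM ?ltW ?powR_gt0// -powRrM.
set P := s `^ (alpha gamma / 2 - 1).
have P0 : 0 < P by exact: powR_gt0.
(* The exponents agree, [3 (alpha / 2 - 1) + 1 = - alpha gamma / 2], by [alphaM]. *)
have -> : s `^ (alpha gamma / 2 * - gamma) = P ^+ 3 * s.
  transitivity (P `^ 3%:R * s `^ 1); last by rewrite powR_mulrn ?powRr1// ltW.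
  rewrite /P -powRrM -powRD; last by rewrite (gt_eqF s0) implybT.
  congr (_ `^ _); lra.
apply: (@le_lt_trans _ _ ((delta gamma * alpha gamma) ^+ 3 * (P ^+ 3 * s))).
  rewrite -mulrA ler_pM2l; last by rewrite exprn_gt0// mulr_gt0//; lra.
  have -> : P ^+ 3 * s = P ^+ 2 * (P * s) by ring.
  rewrite ler_pM2l ?exprn_gt0//.
  rewrite (@le_trans _ _ (P * q))// ?ler_pM2l// gerDr.
  rewrite mulr_le0_ge0 ?exprn_ge0// mulr_le0_ge0 ?powR_ge0//; lra.
by rewrite ltr_pM2r ?delta_alpha3// mulr_gt0// exprn_gt0.
Qed.

Lemma penalization_barrier B y : cutoff gamma B ->
  penalization gamma B eps (barrier gamma eps x0 y) = barrier gamma eps x0 y `^ (- gamma).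
Proof.
move=> [_ _ _ B1].
have d0 := delta_gt0; have e0 : 0 < eps `^ alpha gamma by exact: powR_gt0.
have := barrier_ge_eps y; set b := barrier _ _ _ _ => hb.
rewrite /penalization ifF.
  by rewrite B1 ?mul1r// ler_pdivlMr.
apply/negbTE; rewrite -ltNge; apply: lt_le_trans hb.
by rewrite ltr_pM2r//; lra.
Qed.

Lemma barrier_powR_le y : barrier gamma eps x0 y `^ (- gamma) <=
  (delta gamma / 2) `^ (- gamma) * eps `^ (- (alpha gamma * gamma)).
Proof.
have d0 := delta_gt0; have e0 : 0 < eps `^ alpha gamma by exact: powR_gt0.
rewrite -mulrN powRrM -powRM ?powR_ge0//; last by rewrite ltW// divr_gt0.
apply: ler_powRN; first by case/andP: hgamma.
- by rewrite mulr_gt0// divr_gt0.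
- by apply: le_trans (barrier_ge_eps y); rewrite ler_pM2r//; lra.
Qed.

End constants.

(** * Euclidean balls *)

Lemma enormE (R : realType) (n : nat) (x : 'rV[R]_n) : enorm x = Num.sqrt (sqnorm x).
Proof. by []. Qed.

Lemma enorm_ge0 (R : realType) (n : nat) (x : 'rV[R]_n) : 0 <= enorm x.
Proof. exact: sqrtr_ge0. Qed.

Lemma sqr_enorm (R : realType) (n : nat) (x : 'rV[R]_n) : enorm x ^+ 2 = sqnorm x.
Proof. by rewrite sqr_sqrtr// sqnorm_ge0. Qed.

Lemma enorm0 (R : realType) (n : nat) : enorm (0 : 'rV[R]_n) = 0.
Proof. by rewrite /enorm big1 ?sqrtr0// => i _; rewrite mxE expr0n. Qed.

Lemma enormZ (R : realType) (n : nat) (t : R) (x : 'rV[R]_n) : enorm (t *: x) = `|t| * enorm x.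
Proof.
rewrite !enormE -sqrtr_sqr -sqrtrM ?sqr_ge0//; congr (Num.sqrt _).
by rewrite /sqnorm mulr_sumr; apply: eq_bigr => i _; rewrite mxE exprMn.
Qed.

(** Sum the inequalities [(a x_i - b y_i)^2 >= 0] with weights [a = enorm y] and [b = enorm x], then
    divide by [2 * enorm x * enorm y]; the degenerate cases are treated apart. *)
Lemma cauchy_schwarz_sum (R : realType) (n : nat) (x y : 'rV[R]_n) :
  \sum_(i < n) x ord0 i * y ord0 i <= enorm x * enorm y.
Proof.
have x0 := enorm_ge0 x; have y0 := enorm_ge0 y.
have key a b : 2 * a * b * (\sum_(i < n) x ord0 i * y ord0 i) <=
    a ^+ 2 * enorm x ^+ 2 + b ^+ 2 * enorm y ^+ 2.
  rewrite !sqr_enorm /sqnorm !mulr_sumr -big_split/=; apply: ler_sum => i _.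
  rewrite -subr_ge0.
  suff -> : a ^+ 2 * x ord0 i ^+ 2 + b ^+ 2 * y ord0 i ^+ 2 -
    2 * a * b * (x ord0 i * y ord0 i) = (a * x ord0 i - b * y ord0 i) ^+ 2 by exact: sqr_ge0.
  by ring.
have zero (z : 'rV[R]_n) : enorm z = 0 -> forall i, z ord0 i = 0.
  move=> z0 i; have := sqr_enorm z; rewrite z0 expr0n => /esym/eqP.
  rewrite psumr_eq0 => [/allP/(_ i)|j _]; last exact: sqr_ge0.
  by rewrite mem_index_enum sqrf_eq0 => /(_ isT)/eqP.
have [ex|ex] := eqVneq (enorm x) 0.
  by rewrite ex mul0r big1// => i _; rewrite (zero x ex) mul0r.
have [ey|ey] := eqVneq (enorm y) 0.
  by rewrite ey mulr0 big1// => i _; rewrite (zero y ey) mulr0.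
have xy : 0 < enorm x * enorm y by rewrite mulr_gt0 ?lt0r ?ex ?ey.
rewrite -(ler_pM2l xy) -(@ler_pM2l _ 2)//.
have := key (enorm y) (enorm x); set s := \sum_(i < n) _; nra.
Qed.

Lemma ler_enormD (R : realType) (n : nat) (x y : 'rV[R]_n) : enorm (x + y) <= enorm x + enorm y.
Proof.
have x0 := enorm_ge0 x; have y0 := enorm_ge0 y.
rewrite -(@ler_pXn2r _ 2)// ?nnegrE ?addr_ge0 ?enorm_ge0//.
rewrite sqrrD !sqr_enorm.
have -> : sqnorm (x + y) = sqnorm x + (\sum_(i < n) x ord0 i * y ord0 i) *+ 2 + sqnorm y.
  rewrite /sqnorm -sumrMnl -!big_split/=; apply: eq_bigr => i _.
  by rewrite mxE sqrrD.
by rewrite lerD2r lerD2l lerMn2r cauchy_schwarz_sum.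
Qed.

Lemma continuous_enormB (R : realType) (n : nat) (x : 'rV[R]_n) :
  continuous (fun y : 'rV[R]_n => enorm (y - x)).
Proof.
move=> y; apply: (@continuous_comp _ _ _ (fun y : 'rV[R]_n => sqnorm (y - x)) Num.sqrt).
  exact: continuous_sqnormB.
exact: sqrt_continuous.
Qed.

Definition ecball (R : realType) (n : nat) (x : 'rV[R]_n) (r : R) :
  set 'rV[R]_n := [set y | enorm (y - x) <= r].

Lemma open_eball (R : realType) (n : nat) (x : 'rV[R]_n) (r : R) : open (eball x r).
Proof.
rewrite (_ : eball x r = (fun y => enorm (y - x)) @^-1` [set z : R | z < r])//.
apply: open_comp; last exact: open_lt.
by move=> y _; exact: continuous_enormB.
Qed.

Lemma eball_center (R : realType) (n : nat) (x : 'rV[R]_n) (r : R) : 0 < r -> eball x r x.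
Proof. by move=> r0; rewrite /eball /= subrr enorm0. Qed.

Lemma nbhs_eball (R : realType) (n : nat) (x y : 'rV[R]_n) (r : R) :
  eball x r y -> nbhs y (eball x r).
Proof. by move=> ?; apply: open_nbhs_nbhs; split => //; exact: open_eball. Qed.

Lemma closed_ecball (R : realType) (n : nat) (x : 'rV[R]_n) (r : R) : closed (ecball x r).
Proof.
rewrite (_ : ecball x r = (fun y => enorm (y - x)) @^-1` [set z : R | z <= r])//.
apply: closed_comp; last exact: closed_le.
by move=> y _; exact: continuous_enormB.
Qed.

Lemma closed_esphere (R : realType) (n : nat) (x : 'rV[R]_n) (r : R) :
  closed [set y : 'rV[R]_n | enorm (y - x) = r].
Proof.
rewrite (_ : [set y : 'rV[R]_n | enorm (y - x) = r] =
  (fun y => enorm (y - x)) @^-1` [set z : R | z = r])//.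
apply: closed_comp; last exact: closed_eq.
by move=> y _; exact: continuous_enormB.
Qed.

Lemma ler_coord_enorm (R : realType) (n : nat) (x : 'rV[R]_n) (i : 'I_n) : `|x ord0 i| <= enorm x.
Proof.
rewrite enormE -sqrtr_sqr ler_wsqrtr// /sqnorm (bigD1 i)//= lerDl.
by apply: sumr_ge0 => j _; exact: sqr_ge0.
Qed.

Lemma ler_norm_enorm (R : realType) (n : nat) (x : 'rV[R]_n) : `|x| <= enorm x.
Proof.
rewrite /Num.Def.normr /= mx_normrE; apply: bigmax_le; first exact: enorm_ge0.
by move=> [i j] _ /=; rewrite (ord1 i) ler_coord_enorm.
Qed.

Lemma compact_ecball (R : realType) (n : nat) (x : 'rV[R]_n) (r : R) : compact (ecball x r).
Proof.
apply: bounded_closed_compact; last exact: closed_ecball.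
exists (r + `|x|); split => [|M rM]; first exact: num_real.
move=> y /= yr; apply: le_trans (ltW rM).
rewrite -[y](subrK x) (le_trans (ler_normD _ _))// lerD2r.
exact: le_trans (ler_norm_enorm _) yr.
Qed.

(** The segment from [x] to [y] stays closer to [x] than the boundary does, so it misses the
    boundary. Its trace on [Om] is then both open and closed in it, and connectedness puts the whole
    segment in [Om]. *)
Lemma eball_sub_of_dist (R : realType) (n : nat) (Om : set 'rV[R]_n) (x : 'rV[R]_n) :
  open Om -> Om x -> eball x (euclid_dist x (bdry Om)) `<=` Om.
Proof.
move=> oOm Omx y xy.
pose A := [set x + t *: (y - x) | t in `[(0 : R), 1]].
have A_bdry z : A z -> ~ bdry Om z.
  move=> [t]; rewrite /= in_itv/= => /andP[t0 t1] <- bz.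
  have : euclid_dist x (bdry Om) <= enorm (x + t *: (y - x) - x).
    apply: ge_inf; last by exists (x + t *: (y - x)).
    by exists 0 => _ [w _ <-]; exact: enorm_ge0.
  rewrite leNgt => /negP; apply; apply: le_lt_trans xy.
  by rewrite addrC addKr enormZ ger0_norm// ler_piMl// enorm_ge0.
have cA : connected A.
  apply: connected_continuous_connected; first exact: segment_connected.
  apply: continuous_subspaceT => t.
  apply: cvgD; first exact: cvg_cst.
  by apply: cvgZr_tmp; exact: cvg_id.
have AE : A `&` Om = A.
  apply: cA.
  - exists x; split => //; exists 0; first by rewrite /= in_itv/= lexx ler01.
    by rewrite scale0r addr0.
  - by exists Om.
  - exists (closure Om); first exact: closed_closure.
    apply/seteqP; split => z [Az Oz]; split => //; first exact: subset_closure.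
    apply: contrapT => nz; apply: (A_bdry z Az); split => //.
    by move/interior_subset.
have : A y by exists 1; [rewrite /= in_itv/= ler01 lexx | rewrite scale1r addrC subrK].
by rewrite -AE => -[].
Qed.

(** * Supersolutions and the Perron class *)

Lemma within_continuous_interior (T S : topologicalType) (A : set T)
    (f : T -> S) (x : T) :
  {within A, continuous f} -> nbhs x A -> {for x, continuous f}.
Proof.
move=> /subspace_continuousP cf nA P Pfx.
have := cf x (nbhs_singleton nA) P Pfx.
by apply: filterS2 nA => y Ay; exact.
Qed.

(** A test function touching [v] from below at [x] also touches [w] from below there. Minima and the
    later gluing both reduce to this; [w] may vary with the point. *)
Lemma supersolution_of_local_upper (R : realType) (n : nat) (Om : set 'rV[R]_n)
    (F : R -> R) (v : 'rV[R]_n -> R) :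
  (forall x, Om x -> exists w, [/\ viscosity_supersolution Om F w, w x = v x &
     \forall y \near x, v y <= w y]) ->
  viscosity_supersolution Om F v.
Proof.
move=> H psi x Ox Cpsi mx; have [w [sw wx vw]] := H x Ox.
rewrite -wx; apply: sw Ox Cpsi _; rewrite wx.
by apply: filterS2 mx vw => y h1 h2; rewrite (le_trans h1)// lerB.
Qed.

Lemma classical_supersolution (R : realType) (n : nat) (Om : set 'rV[R]_n)
    (F : R -> R) (w : 'rV[R]_n -> R) :
  open Om -> Ck 2 Om w -> (forall x, Om x -> inf_laplacian w x <= F (w x)) ->
  viscosity_supersolution Om F w.
Proof.
move=> oOm Cw Hw psi x Ox Cpsi mx; apply: le_trans (Hw x Ox).
exact: inf_laplacian_local_min oOm Ox Cw Cpsi mx.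
Qed.

Lemma supersolution_min (R : realType) (n : nat) (Om : set 'rV[R]_n)
    (F : R -> R) (w1 w2 : 'rV[R]_n -> R) :
  viscosity_supersolution Om F w1 -> viscosity_supersolution Om F w2 ->
  viscosity_supersolution Om F (w1 \min w2).
Proof.
move=> s1 s2; apply: supersolution_of_local_upper => x Ox.
have [w12|w21] := leP (w1 x) (w2 x).
  exists w1; split => //=; first by rewrite min_l.
  by near=> y; rewrite ge_min lexx.
exists w2; split => //=; first by rewrite min_r// ltW.
by near=> y; rewrite ge_min lexx orbT.
Unshelve. all: by end_near.
Qed.

(** * Lowering a member of the Perron class by the barrier *)

Section perron.
Variables (R : realType) (gamma : R) (n : nat) (Om : set 'rV[R]_n) (B : R -> R).
Variables (eps : R) (phi ul uo : 'rV[R]_n -> R).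
Hypotheses (hgamma : 0 <= gamma < 1) (eps0 : 0 < eps) (hB : cutoff gamma B).
Hypothesis oOm : open Om.
Hypothesis hul : viscosity_dirichlet_solution Om
  (fun=> (delta gamma / 2) `^ (- gamma) * eps `^ (- (alpha gamma * gamma))) phi ul.

Let P := perron_class gamma B Om eps ul uo.

Lemma perron_class_min w1 w2 : P w1 -> P w2 -> P (w1 \min w2).
Proof.
move=> [c1 s1 b1] [c2 s2 b2]; split.
- by move=> x; apply: (@continuous_min R (subspace (closure Om)) w1 w2 x); [exact: c1 | exact: c2].
- exact: supersolution_min.
- move=> x /[dup] /b1/andP[l1 h1] /b2/andP[l2 h2].
  by rewrite /= le_min l1 l2 ge_min h1.
Qed.

Lemma continuous_of_within_closure (f : 'rV[R]_n -> R) x : {within closure Om, continuous f} -> Om x ->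
  {for x, continuous f}.
Proof.
move=> cf Ox; apply: within_continuous_interior cf _.
apply: filterS (open_nbhs_nbhs (conj oOm Ox)); exact: subset_closure.
Qed.

(* Downward-directedness of the class replaces the extraction of a finite subcover. *)
Lemma perron_class_lt_compact (K : set 'rV[R]_n) (m : R) :
  P !=set0 -> compact K -> K `<=` Om ->
  (forall z, K z -> exists2 w, P w & w z < m) ->
  exists2 w, P w & forall z, K z -> w z < m.
Proof.
move=> [w0 Pw0] cK KOm H.
(* The filter of members lying eventually below any given one. A strict bound at [z] holds near [z]
   by continuity and survives lowering [w], which is the form of covering compactness used next. *)
pose F := filter_from P (fun w => [set w' | P w' /\ forall z, w' z <= w z]).
have FF : Filter F.
  apply: filter_from_filter; first by exists w0.
  move=> w1 w2 P1 P2; exists (w1 \min w2); first exact: perron_class_min.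
  move=> w [Pw /= wm]; split; split => // z; apply: le_trans (wm z) _.
    by rewrite ge_min lexx.
  by rewrite ge_min lexx orbT.
have := (compact_near_coveringP K).1 cK _ F (fun w z => P w /\ w z < m) FF.
case.
  move=> z Kz; have [w Pw wz] := H z Kz.
  have cw : {for z, continuous w}.
    by have [cw _ _] := Pw; exact: continuous_of_within_closure cw (KOm z Kz).
  exists ([set z | w z < m], [set w' | P w' /\ forall z, w' z <= w z]).
    split => /=; last by exists w.
    by have /cvgr_lt := cw; exact.
  move=> [z' w'] /= [h1 [Pw' h2]]; split => //; exact: le_lt_trans (h2 z') h1.
move=> w Pw Hw; exists w => // z Kz.
by have [] := Hw w (conj Pw (fun z => lexx _)) z Kz.
Qed.

Section cut.
Variables (x0 : 'rV[R]_n) (rho : R).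
Hypotheses (rho0 : 0 < rho) (ballOm : ecball x0 rho `<=` Om).

Local Notation Theta := (barrier gamma eps x0).

Lemma supersolution_barrier : viscosity_supersolution Om (penalization gamma B eps) Theta.
Proof.
apply: classical_supersolution => //; first exact: Ck2_barrier.
move=> x _; rewrite penalization_barrier//; exact/ltW/inf_laplacian_barrier_lt.
Qed.

Lemma continuous_barrier x : {for x, continuous Theta}.
Proof. by have [+ _] := @Ck2_barrier R gamma n eps x0 eps0 setT; exact. Qed.

(** A positive maximum of [ul - Theta] would be interior, so [Theta] would be a test function for
    [ul] there. Its infinity Laplacian would be at least the constant right-hand side for [ul],
    against the strict inequality for the barrier. *)
Lemma le_barrier_of_sphere :
  (forall y, enorm (y - x0) = rho -> ul y < Theta y) ->
  forall y, ecball x0 rho y -> ul y <= Theta y.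
Proof.
move=> Hs y By; have [cul sul _ _] := hul.
have cD x : ecball x0 rho x -> {for x, continuous (fun z => ul z - Theta z)}.
  move=> Bx; apply: continuousB; last exact: continuous_barrier.
  exact: continuous_of_within_closure cul (ballOm Bx).
have [||c cB cmax] :=
  @compact_EVT_max _ _ (fun z => ul z - Theta z) _ _ (@compact_ecball R n x0 rho).
- by exists y.
- by apply: continuous_in_subspaceT => x; rewrite inE; exact: cD.
rewrite inE in cB.
have ymax : ul y - Theta y <= ul c - Theta c by apply: cmax; rewrite inE.
rewrite leNgt; apply/negP => yT.
have cT : 0 < ul c - Theta c by apply: lt_le_trans ymax; rewrite subr_gt0.
have cs : eball x0 rho c.
  move: (cB); rewrite /ecball /eball /= le_eqVlt => /orP[/eqP/Hs|//].
  by move: cT; rewrite subr_gt0 => /lt_trans/[apply]; rewrite ltxx.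
have : (delta gamma / 2) `^ (- gamma) * eps `^ (- (alpha gamma * gamma)) <= inf_laplacian Theta c.
  apply: (sul Theta c (ballOm cB) (@Ck2_barrier _ gamma n eps x0 eps0 Om)).
  by apply: filterS (nbhs_eball cs) => z zB; apply: cmax; rewrite inE; exact: ltW.
rewrite leNgt => /negP; apply.
apply: lt_le_trans (inf_laplacian_barrier_lt hgamma x0 eps0 c) _.
exact: barrier_powR_le.
Qed.

Lemma perron_class_cut w : P w -> (forall y, enorm (y - x0) = rho -> w y < Theta y) ->
  exists2 v, P v & v x0 <= Theta x0.
Proof.
move=> [cw sw bw] Hs.
pose v y := if enorm (y - x0) < rho then Num.min (w y) (Theta y) else w y.
have vw y : v y <= w y by rewrite /v; case: ifP => // _; rewrite ge_min lexx.
have vin y : eball x0 rho y -> \forall z \near y, v z = Num.min (w z) (Theta z).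
  by move=> /nbhs_eball; apply: filterS => z; rewrite /v /eball /= => ->.
(* On the sphere the strict inequality [w < Theta] persists nearby, so the minimum is [w] on the
   inner side as well and the cut leaves no jump. *)
have vout y : closure Om y -> ~ eball x0 rho y ->
    \forall z \near within (closure Om) (nbhs y), v z = w z.
  move=> Oy /negP; rewrite -leNgt le_eqVlt => /orP[/eqP/esym yr|yr].
    have Oy' : Om y by apply: ballOm; rewrite /ecball /= yr.
    have : \forall z \near y, w z < Theta z.
      have cD : {for y, continuous (fun z => w z - Theta z)}.
        by apply: continuousB; [exact: continuous_of_within_closure cw Oy' | exact: continuous_barrier].
      have /cvgr_lt/(_ 0) := cD; rewrite subr_lt0 => /(_ (Hs y yr)).
      by apply: filterS => z; rewrite subr_lt0.
    move=> H; apply: cvg_within; move: H; apply: filterS => z zT.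
    by rewrite /v; case: ifP => // _; rewrite min_l// ltW.
  apply: cvg_within; have /cvgr_gt/(_ rho yr) := @continuous_enormB R n x0 y.
  by apply: filterS => z zr; rewrite /v ltNge (ltW zr).
exists v; last by rewrite /v subrr enorm0 rho0 ge_min lexx orbT.
split.
- apply/subspace_continuousP => y Oy.
  suff : v z @[z --> within (closure Om) (nbhs y)] --> v y by [].
  have cwy := (subspace_continuousP _ _).1 cw y Oy.
  have [yB|yB] := pselect (eball x0 rho y).
    have Oy' : Om y by apply: ballOm; exact: ltW.
    have cm : {for y, continuous (w \min Theta)}.
      by apply: continuous_min; [exact: continuous_of_within_closure cw Oy' | exact: continuous_barrier].
    rewrite (nbhs_singleton (vin y yB)); apply: cvg_within_filter.
    by apply: cvg_trans cm; apply: near_eq_cvg; apply: filterS (vin y yB) => z ->.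
  have -> : v y = w y by rewrite /v ifF//; apply/negbTE/negP.
  by apply: cvg_trans cwy; apply: near_eq_cvg; apply: filterS (vout y Oy yB) => z ->.
(* Where [v] meets [w], the function [w] lies above [v] everywhere, also across the sphere.
   Otherwise [x] is inside the ball and [v] equals [Theta] there. *)
- apply: supersolution_of_local_upper => x Ox.
  have [vx|vx] := eqVneq (v x) (w x).
    by exists w; split => //; near=> y.
  have xB : eball x0 rho x.
    by move: vx; rewrite /v /eball /=; case: ifP => //; rewrite eqxx.
  exists Theta; split; first exact: supersolution_barrier.
    move: vx; rewrite /v; move: xB; rewrite /eball /= => ->.
    by case: leP => //; rewrite eqxx.
  by apply: filterS (vin x xB) => z ->; rewrite ge_min lexx orbT.
- move=> x Ox; have /andP[lx hx] := bw x Ox; apply/andP; split; last exact: le_trans (vw x) hx.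
  rewrite /v; case: ifP => // xr; rewrite le_min lx /=.
  apply: le_barrier_of_sphere; last exact: ltW.
  move=> y yr; apply: le_lt_trans (Hs y yr).
  have yB : ecball x0 rho y by rewrite /ecball /= yr.
  by have /andP[] := bw y (subset_closure (ballOm yB)).
Unshelve. all: by end_near.
Qed.
End cut.
End perron.

(** * Minimal solutions and passage to the limit *)

Lemma uniform_cvg_dist_lt (R : realType) (T : choiceType) (K : set T)
    (f : nat -> T -> R) (g : T -> R) (e : R) :
  {uniform K, f @ \oo --> g} -> 0 < e ->
  \forall k \near \oo, forall y, K y -> `|g y - f k y| < e.
Proof.
move=> fg e0.
apply: (fg [set h : T -> R | forall y, K y -> `|g y - h y| < e]).
apply/uniform_nbhs; exists [set xy : R * R | ball xy.1 e xy.2]; split; last first.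
  by move=> h Hh y /Hh; rewrite /= -ball_normE.
by rewrite -entourage_from_ballE; exists e.
Qed.

Section minimal.
Variables (R : realType) (gamma : R) (n : nat) (Om : set 'rV[R]_n) (B : R -> R).
Variables (eps : R) (phi ue : 'rV[R]_n -> R) (x0 : 'rV[R]_n) (rho : R).
Hypotheses (hgamma : 0 <= gamma < 1) (eps0 : 0 < eps) (hB : cutoff gamma B).
Hypotheses (oOm : open Om) (ballOm : ecball x0 rho `<=` Om).
Hypothesis hue : minimal_solution gamma B Om phi eps ue.

Lemma minimal_solution_center_le : 0 < rho ->
  (forall y, enorm (y - x0) = rho -> ue y < delta gamma * rho `^ alpha gamma) ->
  ue x0 <= delta gamma * eps `^ alpha gamma.
Proof.
move=> rho0 Hs; have [ul [uo [hul _ ueE]]] := hue.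
have OmE y : ecball x0 rho y -> closure Om y by move=> /ballOm; exact: subset_closure.
have x0B : ecball x0 rho x0 by rewrite /ecball /= subrr enorm0 ltW.
pose P := perron_class gamma B Om eps ul uo.
have lbP y : closure Om y -> has_lbound [set w y | w in P].
  by move=> Oy; exists (ul y) => _ [w [_ _ bw] <-]; have /andP[] := bw y Oy.
(* For an empty class the infimum takes its default value [0], which satisfies the bound. *)
have [P0|P0] := pselect (P !=set0); last first.
  rewrite ueE; last exact: OmE.
  suff -> : [set w x0 | w in perron_class gamma B Om eps ul uo] = set0.
    by rewrite inf0 mulr_ge0 ?powR_ge0// ltW// delta_gt0.
  by rewrite -subset0 => z [w Pw _]; apply: P0; exists w.
have sphB y : enorm (y - x0) = rho -> ecball x0 rho y by move=> yr; rewrite /ecball /= yr.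
have [|z /sphB|z zr|w Pw Hw] := @perron_class_lt_compact _ gamma n Om B eps ul uo oOm
    [set y | enorm (y - x0) = rho] (delta gamma * rho `^ alpha gamma) P0.
- apply: (subclosed_compact (@closed_esphere _ _ x0 rho) (@compact_ecball _ _ x0 rho)).
  by move=> y /sphB.
- exact: ballOm.
- have := Hs z zr; rewrite ueE; last exact/OmE/sphB.
  move=> /inf_lt[|_ [w Pw <-] wz]; last by exists w.
  by have [w Pw] := P0; exists (w z), w.
have [|v Pv vx] := perron_class_cut hgamma eps0 hB oOm hul rho0 ballOm Pw.
  (* On the sphere the barrier is at least [delta * rho^alpha], by [barrier_ge] with [t = rho]. *)
  move=> y yr; apply: lt_le_trans (Hw y yr) _; apply: barrier_ge => //; first exact: ltW.
  by rewrite -sqr_enorm yr lerDl exprn_ge0// ltW.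
rewrite barrier_center// in vx; apply: le_trans vx.
rewrite ueE; last exact: OmE.
by apply: ge_inf; [exact/lbP/OmE | exists v].
Qed.

(** Makes the supremum in the theorem a genuine upper bound of the values of [u]. The bound comes
    from the maximum of [uo] on the ball, or from the default infimum [0] if the class is empty. *)
Lemma minimal_solution_bounded_above : exists M, forall y, ecball x0 rho y -> ue y <= M.
Proof.
have [ul [uo [_ [cuo _ _ _] ueE]]] := hue.
have OmE y : ecball x0 rho y -> closure Om y by move=> /ballOm; exact: subset_closure.
pose P := perron_class gamma B Om eps ul uo.
have [[y0 y0B]|B0] := pselect (ecball x0 rho !=set0); last first.
  by exists 0 => y yB; exfalso; apply: B0; exists y.
have [||c _ cmax] := @compact_EVT_max _ _ uo _ _ (@compact_ecball R n x0 rho).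
- by exists y0.
- apply: continuous_in_subspaceT => y; rewrite inE => /ballOm Oy.
  exact: (continuous_of_within_closure oOm cuo Oy).
have [[w Pw]|P0] := pselect (P !=set0).
  exists (uo c) => y yB; apply: (@le_trans _ _ (uo y)); last by apply: cmax; rewrite inE.
  have [_ _ bw] := Pw; have /andP[_] := bw y (OmE y yB); apply: le_trans.
  rewrite ueE; last exact: OmE.
  apply: ge_inf; last by exists w.
  exists (ul y) => _ [w' [_ _ bw'] <-]; have /andP[] // := bw' y (OmE y yB).
exists 0 => y yB; rewrite ueE; last exact: OmE.
suff -> : [set w y | w in perron_class gamma B Om eps ul uo] = set0 by rewrite inf0.
by rewrite -subset0 => z [w Pw _]; apply: P0; exists w.
Qed.
End minimal.

Theorem theorem2 (R : realType) (gamma : R) (hgamma : 0 <= gamma < 1) :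
  exists2 c : R, 0 < c &
    forall (n : nat) (Om : set 'rV[R]_n) (phi : 'rV[R]_n -> R) (B : R -> R)
      (u : 'rV[R]_n -> R),
      (0 < n)%N ->
      bounded_smooth_domain Om ->
      smooth setT phi ->
      (forall x, bdry Om x -> 0 <= phi x) ->
      cutoff gamma B ->
      limit_perron_solution gamma B Om phi u ->
      forall x : 'rV[R]_n, closure (positivity_set Om u) x -> Om x ->
      forall r : R, 0 < r -> r <= euclid_dist x (bdry Om) / 2 ->
        c * r `^ alpha gamma <= sup [set u y | y in eball x r].
Proof.
have d0 := delta_gt0 hgamma; have a1 := alpha_gt1 hgamma.
(* The factor [2^-alpha] pays for working at radius [r / 2] around a nearby point where [u] is
   positive. *)
exists (delta gamma * 2^-1 `^ alpha gamma); first by rewrite mulr_gt0// powR_gt0.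
move=> n Om phi B u _ [oOm _ _ _ _] _ _ hB [eps [ue [eps0 epscvg hue ucvg]]].
move=> x clx Omx r r0 rdist.
have BrOm : ecball x r `<=` Om.
  move=> y yB; apply: (eball_sub_of_dist oOm Omx); apply: le_lt_trans yB _.
  by lra.
have [M uM] : exists M, forall y, ecball x r y -> u y <= M.
  have [k _ /(_ k (leqnn k)) Hk] :=
    uniform_cvg_dist_lt (ucvg _ (compact_ecball (x:=x) (r:=r)) BrOm) ltr01.
  have [M HM] := minimal_solution_bounded_above oOm BrOm (hue k).
  exists (M + 1) => y yB; have := Hk y yB; have := HM y yB.
  by rewrite ltr_norml => h /andP[_]; lra.
pose rho := r / 2; have rho0 : 0 < rho by exact: divr_gt0.
(* The point [x] itself may be a zero of [u]; the closure provides a positive value within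
   [r / 2]. *)
have [x' [[Omx' ux'] xx']] := clx _ (nbhs_eball (eball_center x rho0)).
have B'r : ecball x' rho `<=` eball x r.
  move=> y; rewrite /ecball /eball /= => yx'.
  have -> : y - x = (y - x') + (x' - x) by rewrite addrA subrK.
  apply: le_lt_trans (ler_enormD _ _) _.
  by rewrite [ltRHS]splitr; exact: ler_ltD yx' xx'.
have B'Om : ecball x' rho `<=` Om.
  by move=> y /B'r yr; apply: BrOm; exact: ltW.
have -> : delta gamma * 2^-1 `^ alpha gamma * r `^ alpha gamma = delta gamma * rho `^ alpha gamma.
  by rewrite -mulrA -powRM ?invr_ge0// ?ltW// [2^-1 * r]mulrC.
rewrite leNgt; apply/negP => supr.
have ule y : ecball x' rho y -> u y <= sup [set u y | y in eball x r].
  move=> /B'r yr; apply: ub_le_sup; last by exists y.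
  by exists M => _ [z zr <-]; apply: uM; exact: ltW.
set S := sup _ in supr ule.
have cK := compact_ecball (x:=x') (r:=rho).
have H1 : \forall k \near \oo, ue k x' <= delta gamma * eps k `^ alpha gamma.
  (* This gap is the tolerance that carries the strict bound from [u] over to [ue k] on the
     sphere. *)
  have e0 : 0 < delta gamma * rho `^ alpha gamma - S by rewrite subr_gt0.
  have := uniform_cvg_dist_lt (ucvg _ cK B'Om) e0; apply: filterS => k Hk.
  apply: (minimal_solution_center_le hgamma (eps0 k) hB oOm B'Om (hue k)) => //.
  move=> y yr; have yB : ecball x' rho y by rewrite /ecball /= yr.
  by have := Hk y yB; have := ule y yB; rewrite ltr_norml => h /andP[h2 _]; lra.
have u2 : 0 < u x' / 2 by exact: divr_gt0.
have x'B : ecball x' rho x' by rewrite /ecball /= subrr enorm0 ltW.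
have H2 := uniform_cvg_dist_lt (ucvg _ cK B'Om) u2.
(* Below [1], [eps^alpha <= eps] because [alpha > 1]; the second bound gives
   [delta * eps < u x' / 2]. Then [ue k x' < u x' / 2], while uniform convergence gives
   [ue k x' > u x' / 2]. *)
pose t := Num.min 1 (u x' / (2 * delta gamma)).
have t0 : 0 < t by rewrite lt_min ltr01 divr_gt0// mulr_gt0.
have H3 : \forall k \near \oo, eps k < t by exact: (cvgr_lt _ epscvg).
have [k _ /(_ k (leqnn k)) [[h1 h2] h3]] := filterI (filterI H1 H2) H3.
have := h2 x' x'B; rewrite ltr_norml => /andP[_ h4].
move: h3; rewrite lt_min => /andP[e1 e2].
have h5 : eps k `^ alpha gamma <= eps k.
  by apply: ge1r_powR; [rewrite eps0 ltW | exact: ltW].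
have : delta gamma * eps k < u x' / 2.
  by rewrite ltr_pdivlMr// in e2; lra.
have : delta gamma * eps k `^ alpha gamma <= delta gamma * eps k by rewrite ler_pM2l.
by lra.
Qed.
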